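(* Let $M_4$ be the Turing machine with states $A,B,C,D,E,F$ (plus the halting state $H$), symbols $0,1$ ($0$ blank) and transition table $\delta(A,0)=(1,R,B)$, $\delta(A,1)=(1,L,E)$; $\delta(B,0)=(1,R,C)$, $\delta(B,1)=(1,R,F)$; $\delta(C,0)=(1,L,D)$, $\delta(C,1)=(0,R,B)$; $\delta(D,0)=(1,R,E)$, $\delta(D,1)=(0,L,C)$; $\delta(E,0)=(1,L,A)$, $\delta(E,1)=(0,R,D)$; $\delta(F,0)=(1,R,H)$, $\delta(F,1)=(1,R,C)$. For $n\ge 0$ let $C(n) = {}^\omega 0\,(A0)\,1^n\,0^\omega$. Then (a) $C(0) \vdash(29)\ C(9)$; (b) $C(2)\vdash(36)\ C(11)$; (c) $C(3)\vdash(48)\ C(13)$; and, for all integers $k\ge 0$: (d) $C(3k+1) \vdash(3k+3)\ {}^\omega 0\,1\,1\,1\,(0\,1\,1)^k\,(H0)\,0^\omega$; (e) $C(9k+5) \vdash\big((4802\cdot 16^{k+1} + 6370\cdot 4^{k+1} + 2280k - 25362)/270\big)\ C\big((98\cdot 4^k - 11)/3\big)$; (f) $C(9k+6) \vdash\big((125\cdot 16^{k+2} - 575\cdot 4^{k+2} + 228k - 2226)/27\big)\ C\big((50\cdot 4^{k+1} - 59)/3\big)$; (g) $C(9k+8) \vdash\big((4802\cdot 16^{k+1} + 6370\cdot 4^{k+1} + 2280k - 11592)/270\big)\ C\big((98\cdot 4^k + 1)/3\big)$; (h) $C(9k+9) \vdash\big((125\cdot 16^{k+2} + 325\cdot 4^{k+2}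 + 228k - 2289)/27\big)\ C\big((50\cdot 4^{k+1} - 11)/3\big)$; (i) $C(9k+11) \vdash\big((4802\cdot 16^{k+2} - 11270\cdot 4^{k+2} + 2280k - 22452)/270\big)\ C\big((98\cdot 4^{k+1} - 59)/3\big)$; (j) $C(9k+12) \vdash\big((125\cdot 16^{k+2} + 325\cdot 4^{k+2} + 228k - 912)/27\big)\ C\big((50\cdot 4^{k+1} + 1)/3\big)$.
   Context: Turing machines here have one tape, infinite in both directions. $\delta(q,a)=(b,D,q')$ means: in state $q$ reading symbol $a$, the machine writes $b$ on the current cell, moves the head one cell left ($D=L$) or right ($D=R$), and enters state $q'$. When the machine enters the halting state $H$ it stops. A configuration is written ${}^\omega 0\, x\,(S a)\, y\, 0^\omega$, where $x,y$ are finite words: the tape contains the word $xay$ surrounded on both sides by infinitely many $0$'s, the machine is in state $S$, and the head scans the cell containing the displayed symbol $a$. Each digit is one tape symbol; $w^n$ denotes the concatenation of $n$ copies of $w$ (an exponent applies to the single preceding symbol unless parentheses are used), $w^0$ is empty. $C_1 \vdash(t)\ C_2$ means that the machine, started in configuration $C_1$, is in configuration $C_2$ after exactly $t$ steps. *)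

(* Defs.v *)
From Stdlib Require Import ZArith QArith List.
Import ListNotations.

Inductive symbol := s0 | s1.
Inductive dir := L | R.
Inductive state := qA | qB | qC | qD | qE | qF | qH.

(* [None]: no transition, i.e. the machine has stopped. *)
Definition table := state -> symbol -> option (symbol * dir * state).

Definition M4 : table := fun q a =>
  match q, a with
  | qA, s0 => Some (s1, R, qB) | qA, s1 => Some (s1, L, qE)
  | qB, s0 => Some (s1, R, qC) | qB, s1 => Some (s1, R, qF)
  | qC, s0 => Some (s1, L, qD) | qC, s1 => Some (s0, R, qB)
  | qD, s0 => Some (s1, R, qE) | qD, s1 => Some (s0, L, qC)
  | qE, s0 => Some (s1, L, qA) | qE, s1 => Some (s0, R, qD)
  | qF, s0 => Some (s1, R, qH) | qF, s1 => Some (s1, R, qC)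
  | qH, _  => None
  end.

Record machine := Machine { mstate : state; mtape : Z -> symbol; mhead : Z }.

Definition move (d : dir) (p : Z) : Z :=
  match d with L => p - 1 | R => p + 1 end.

Definition write (T : Z -> symbol) (p : Z) (b : symbol) : Z -> symbol :=
  fun i => if Z.eqb i p then b else T i.

Definition step (delta : table) (c : machine) : option machine :=
  match delta (mstate c) (mtape c (mhead c)) with
  | Some (b, d, q) =>
      Some (Machine q (write (mtape c) (mhead c) b) (move d (mhead c)))
  | None => None
  end.

(* [None] when the machine stops before having made [t] steps. *)
Fixpoint nsteps (delta : table) (t : nat) (c : machine) : option machine :=
  match t with
  | O => Some c
  | S t' =>
      match step delta c with
      | Some c' => nsteps delta t' c'
      | None => None
      end
  end.

(* [Config x q a y] is the written configuration  ^w0 x (q a) y 0^w. *)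
Record config := Config
  { cleft : list symbol; cstate : state; cscan : symbol; cright : list symbol }.

(* The two-sided infinite word  ^w0 w 0^w, with [w] starting at cell 0. *)
Definition padded (w : list symbol) (i : Z) : symbol :=
  if Z.ltb i 0 then s0 else nth (Z.to_nat i) w s0.

(* A written configuration does not fix the absolute position on the tape: [c]
   is in it when the word [x a y] lies on the tape with the head on [a]. *)
Definition in_config (c : machine) (C : config) : Prop :=
  mstate c = cstate C /\
  forall i : Z,
    mtape c (mhead c - Z.of_nat (length (cleft C)) + i)%Z
    = padded (cleft C ++ cscan C :: cright C) i.

Definition reaches (delta : table) (t : nat) (C1 C2 : config) : Prop :=
  forall c, in_config c C1 ->
    exists c', nsteps delta t c = Some c' /\ in_config c' C2.

Definition wpow (w : list symbol) (n : nat) : list symbol := concat (repeat w n).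

Definition Cn (n : nat) : config := Config [] qA s0 (wpow [s1] n).

(* C(n) |-(T) C(N) for [T] and [N] given by fractions; that these fractions are
   natural numbers is part of the assertion. *)
Definition M4_Cn_reaches (n : nat) (T N : Q) : Prop :=
  exists t m : nat,
    inject_Z (Z.of_nat t) == T /\ inject_Z (Z.of_nat m) == N /\
    reaches M4 t (Cn n) (Cn m).

(* Main.v *)
Require Import Defs.
From Stdlib Require Import ZArith QArith List Lia.
Import ListNotations.

(** Write [P(X,a)] for [X (C1) (01)^a 1^6] and [Q(X,a)] for [X (C1) (01)^a 1^8],
    where [X] is the left part of the tape.
    - [P(X 01 0, a)] leads to [P(X 0, a+4)], hence [P(X (01)^n 0, a)] to
      [P(X 0, a+4n)] in quadratic time.
    - [Q(X, a)] leads to [P(X (01)^a 0, 3)], hence to [P(X 0, 4a+3)].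
    - With [F(m,a) = P(111 (011)^m 0, a)] and [G(m,a) = Q(111 (011)^m 0, a)],
      [F(m+2,a)] leads to [G(m,a+8)] and [G(m+1,a)] to [F(m,4a+8)].

    So [F(m+3,a)] leads to [F(m,4a+40)] and [G(m+3,a)] to [G(m,4a+16)]; the
    quantities [3a+40] and [3a+16] are multiplied by 4, which gives the powers
    of 4 in the lengths and the powers of 16 in the times. [C(3m+11)] enters
    [F(m,3)] and [C(3m+12)] enters [G(m,3)]. When the blocks [011] are used up
    the machine bounces between the ends of the tape, fills it with 1's and
    reaches some [C(n)]. *)

(** * Half-tape configurations *)

(* [(q, l, r)]: [l] is the tape to the left of the head, read leftwards; [r] is
   the tape from the scanned cell on, read rightwards; blanks beyond both ends. *)
Definition zipper : Type := state * list symbol * list symbol.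

Definition zstep (delta : table) (c : zipper) : option zipper :=
  let '(q, l, r) := c in
  match delta q (hd s0 r) with
  | Some (b, R, q') => Some (q', b :: l, tl r)
  | Some (b, L, q') => Some (q', tl l, hd s0 l :: b :: tl r)
  | None => None
  end.

Fixpoint znsteps (delta : table) (t : nat) (c : zipper) : option zipper :=
  match t with
  | O => Some c
  | S t' =>
      match zstep delta c with
      | Some c' => znsteps delta t' c'
      | None => None
      end
  end.

Definition on_tape (c : machine) (z : zipper) : Prop :=
  let '(q, l, r) := z in
  mstate c = q /\
  (forall i : nat, mtape c (mhead c + Z.of_nat i)%Z = nth i r s0) /\
  (forall i : nat, mtape c (mhead c - 1 - Z.of_nat i)%Z = nth i l s0).

Lemma hd_nth (l : list symbol) : hd s0 l = nth 0 l s0.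
Proof. now destruct l. Qed.

Lemma nth_tl (i : nat) (l : list symbol) : nth i (tl l) s0 = nth (S i) l s0.
Proof. destruct l as [|x l]; [now destruct i | reflexivity]. Qed.

Lemma on_tape_step (delta : table) (c : machine) (z z' : zipper) :
  on_tape c z -> zstep delta z = Some z' ->
  exists c', step delta c = Some c' /\ on_tape c' z'.
Proof.
  destruct z as [[q l] r]; intros (Hq & Hr & Hl) H.
  unfold step; cbn in H.
  replace (mtape c (mhead c)) with (hd s0 r)
    by (rewrite hd_nth, <- Hr; f_equal; lia).
  rewrite Hq.
  destruct (delta q (hd s0 r)) as [[[b d] q']|]; [|discriminate].
  eexists; split; [reflexivity|].
  destruct d; injection H as <-; cbn; unfold write; repeat split; intros i.
  - destruct i as [|[|i]]; cbn [nth].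
    + rewrite hd_nth, <- Hl. destruct (Z.eqb_spec (mhead c - 1 + Z.of_nat 0) (mhead c));
        [lia | f_equal; lia].
    + destruct (Z.eqb_spec (mhead c - 1 + Z.of_nat 1) (mhead c)); [reflexivity | lia].
    + rewrite nth_tl, <- Hr.
      destruct (Z.eqb_spec (mhead c - 1 + Z.of_nat (S (S i))) (mhead c));
        [lia | f_equal; lia].
  - rewrite nth_tl, <- Hl.
    destruct (Z.eqb_spec (mhead c - 1 - 1 - Z.of_nat i) (mhead c)); [lia | f_equal; lia].
  - rewrite nth_tl, <- Hr.
    destruct (Z.eqb_spec (mhead c + 1 + Z.of_nat i) (mhead c)); [lia | f_equal; lia].
  - destruct i as [|i]; cbn [nth].
    + destruct (Z.eqb_spec (mhead c + 1 - 1 - Z.of_nat 0) (mhead c)); [reflexivity | lia].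
    + rewrite <- Hl.
      destruct (Z.eqb_spec (mhead c + 1 - 1 - Z.of_nat (S i)) (mhead c));
        [lia | f_equal; lia].
Qed.

Lemma on_tape_nsteps (delta : table) (t : nat) (c : machine) (z z' : zipper) :
  on_tape c z -> znsteps delta t z = Some z' ->
  exists c', nsteps delta t c = Some c' /\ on_tape c' z'.
Proof.
  revert c z; induction t as [|t IH]; intros c z Hc H; cbn in *.
  - injection H as <-. now exists c.
  - destruct (zstep delta z) as [z1|] eqn:E; [|discriminate].
    destruct (on_tape_step _ _ _ _ Hc E) as (c1 & -> & Hc1).
    exact (IH _ _ Hc1 H).
Qed.

(** In the word [x a y] the scanned cell has index [length x]; negative indices fall beyond the end
    of [rev x], where [nth] returns its default, the blank. *)
Lemma on_tape_in_config (c : machine) (C : config) :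
  in_config c C <-> on_tape c (cstate C, rev (cleft C), cscan C :: cright C).
Proof.
  destruct C as [x q a y]; unfold in_config, on_tape, padded; cbn [cleft cstate cscan cright].
  split; intros (Hq & H); (split; [exact Hq|]).
  - split; intros i.
    + specialize (H (Z.of_nat (length x + i))).
      replace (mhead c - Z.of_nat (length x) + Z.of_nat (length x + i))%Z
        with (mhead c + Z.of_nat i)%Z in H by lia.
      rewrite H. destruct (Z.ltb_spec (Z.of_nat (length x + i)) 0); [lia|].
      rewrite Nat2Z.id, app_nth2 by lia. f_equal; lia.
    + specialize (H (Z.of_nat (length x) - 1 - Z.of_nat i)%Z).
      replace (mhead c - Z.of_nat (length x) + (Z.of_nat (length x) - 1 - Z.of_nat i))%Z
        with (mhead c - 1 - Z.of_nat i)%Z in H by lia.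
      rewrite H. destruct (Z.ltb_spec (Z.of_nat (length x) - 1 - Z.of_nat i) 0).
      * rewrite nth_overflow; [reflexivity|]. rewrite length_rev; lia.
      * rewrite app_nth1, rev_nth by lia. f_equal; lia.
  - destruct H as [Hr Hl]; intros i.
    destruct (Z.ltb_spec i 0).
    + specialize (Hl (Z.to_nat (Z.of_nat (length x) - 1 - i))).
      rewrite nth_overflow in Hl by (rewrite length_rev; lia).
      rewrite <- Hl. f_equal; lia.
    + destruct (Z.ltb_spec i (Z.of_nat (length x))).
      * specialize (Hl (Z.to_nat (Z.of_nat (length x) - 1 - i))).
        rewrite rev_nth in Hl by lia.
        rewrite app_nth1 by lia.
        replace (Z.to_nat i)
          with (length x - S (Z.to_nat (Z.of_nat (length x) - 1 - i)))%nat by lia.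
        rewrite <- Hl. f_equal; lia.
      * specialize (Hr (Z.to_nat (i - Z.of_nat (length x)))).
        rewrite app_nth2 by lia.
        replace (Z.to_nat i - length x)%nat
          with (Z.to_nat (i - Z.of_nat (length x))) by lia.
        rewrite <- Hr. f_equal; lia.
Qed.

(** For the halting configuration: the run ends with an empty right half, while [Config] displays
    the scanned blank. *)
Lemma on_tape_blank_scan (c : machine) (q : state) (l : list symbol) :
  on_tape c (q, l, []) -> on_tape c (q, l, [s0]).
Proof.
  intros (Hq & Hr & Hl); repeat split; trivial.
  intros i; rewrite Hr; now destruct i as [|[|i]].
Qed.

(** * Timed runs of [M4] *)

Definition run (t : nat) (z z' : zipper) : Prop := znsteps M4 t z = Some z'.

Lemma run_trans (t t' : nat) (z z' z'' : zipper) :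
  run t z z' -> run t' z' z'' -> run (t + t') z z''.
Proof.
  unfold run; revert z; induction t as [|t IH]; intros z H H'; cbn in *.
  - now injection H as ->.
  - destruct (zstep M4 z); [now apply IH | discriminate].
Qed.

Lemma run_trans_eq (t t' s : nat) (z z' z'' : zipper) :
  run t z z' -> run t' z' z'' -> (t + t' = s)%nat -> run s z z''.
Proof. intros H H' <-. eapply run_trans; eassumption. Qed.

Lemma run_cast (t s : nat) (z z1 z2 : zipper) :
  run t z z1 -> z1 = z2 -> t = s -> run s z z2.
Proof. now intros H <- <-. Qed.

Lemma run_reaches (t : nat) (C C' : config) :
  run t (cstate C, rev (cleft C), cscan C :: cright C)
        (cstate C', rev (cleft C'), cscan C' :: cright C') ->
  reaches M4 t C C'.
Proof.
  intros H c Hc.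
  apply on_tape_in_config in Hc.
  destruct (on_tape_nsteps _ _ _ _ _ Hc H) as (c' & Hn & Hc').
  exists c'; split; [exact Hn|]. now apply on_tape_in_config.
Qed.

(** * Periodic words *)

Fixpoint pairs (a b : symbol) (n : nat) (w : list symbol) : list symbol :=
  match n with O => w | S n => a :: b :: pairs a b n w end.

Fixpoint ones (n : nat) (w : list symbol) : list symbol :=
  match n with O => w | S n => s1 :: ones n w end.

(* The reversal of [(011)^n]. *)
Fixpoint blocks (n : nat) (w : list symbol) : list symbol :=
  match n with O => w | S n => s1 :: s1 :: s0 :: blocks n w end.

(** A sweep may leave an alternating word cut into pairs at one parity where the next step needs it
    cut at the other. *)
Lemma pairs_shift (a b : symbol) (n : nat) (w : list symbol) :
  a :: pairs b a n w = pairs a b n (a :: w).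
Proof. induction n as [|n IH]; cbn; [reflexivity | now rewrite IH]. Qed.

Lemma pairs_add (a b : symbol) (n m : nat) (w : list symbol) :
  pairs a b n (pairs a b m w) = pairs a b (n + m) w.
Proof. induction n as [|n IH]; cbn; [reflexivity | now rewrite IH]. Qed.

Lemma pairs_succ (a b : symbol) (n : nat) (w : list symbol) :
  pairs a b n (a :: b :: w) = pairs a b (n + 1) w.
Proof. exact (pairs_add a b n 1 w). Qed.

Lemma ones_add (n m : nat) (w : list symbol) : ones n (ones m w) = ones (n + m) w.
Proof. induction n as [|n IH]; cbn; [reflexivity | now rewrite IH]. Qed.

Lemma blocks_snoc (n : nat) (w : list symbol) :
  blocks n (s1 :: s1 :: s0 :: w) = blocks (S n) w.
Proof. induction n as [|n IH]; cbn; [reflexivity|]. now rewrite IH. Qed.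

Lemma wpow_ones (n : nat) : wpow [s1] n = ones n [].
Proof. induction n as [|n IH]; [reflexivity|]. cbn. f_equal. exact IH. Qed.

Lemma rev_wpow_blocks (n : nat) (w : list symbol) :
  rev (w ++ wpow [s0; s1; s1] n) = blocks n (rev w).
Proof.
  revert w; induction n as [|n IH]; intros w.
  - cbn. now rewrite app_nil_r.
  - change (wpow [s0; s1; s1] (S n)) with ([s0; s1; s1] ++ wpow [s0; s1; s1] n).
    rewrite app_assoc, IH, rev_app_distr. apply blocks_snoc.
Qed.

(** * Sweeps *)

(** Each sweep iterates a cycle of the table. Here [C] turns 1 into 0 and [B] turns 0 into 1, both
    moving right. *)
Lemma sweep_CB (n : nat) (l r : list symbol) :
  run (2 * n) (qC, l, pairs s1 s0 n r) (qC, pairs s1 s0 n l, r).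
Proof.
  revert l; induction n as [|n IH]; intros l; [reflexivity|].
  apply (run_trans_eq 2 (2 * n) _ _ (qC, s1 :: s0 :: l, pairs s1 s0 n r));
    [reflexivity | | lia].
  cbn. rewrite pairs_shift, pairs_shift. apply IH.
Qed.

(** On 1's the cycle [C], [B], [F] changes only the first of every three: this creates the blocks
    [011]. *)
Lemma sweep_CBF (n : nat) (l r : list symbol) :
  run (3 * n) (qC, l, ones (3 * n) r) (qC, blocks n l, r).
Proof.
  revert l; induction n as [|n IH]; intros l; [reflexivity|].
  replace (3 * S n)%nat with (3 + 3 * n)%nat by lia.
  eapply run_trans; [reflexivity|]. rewrite <- blocks_snoc. apply IH.
Qed.

Lemma sweep_DC (n : nat) (l r : list symbol) :
  run (2 * n + 2) (qD, pairs s0 s1 n (s0 :: l), s1 :: r)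
    (qD, tl l, hd s0 l :: pairs s1 s0 (n + 1) r).
Proof.
  revert r; induction n as [|n IH]; intros r; [reflexivity|].
  apply (run_trans_eq 2 (2 * n + 2) _ _
           (qD, pairs s0 s1 n (s0 :: l), s1 :: s1 :: s0 :: r)); [reflexivity | | lia].
  replace (S n + 1)%nat with (n + 1 + 1)%nat by lia.
  rewrite <- (pairs_succ s1 s0 (n + 1)). apply IH.
Qed.

Lemma sweep_CD (n : nat) (l r : list symbol) :
  run (2 * n + 2) (qC, pairs s1 s0 n (s1 :: l), s0 :: r)
    (qC, tl l, hd s0 l :: pairs s0 s1 (n + 1) r).
Proof.
  revert r; induction n as [|n IH]; intros r; [reflexivity|].
  apply (run_trans_eq 2 (2 * n + 2) _ _
           (qC, pairs s1 s0 n (s1 :: l), s0 :: s0 :: s1 :: r)); [reflexivity | | lia].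
  replace (S n + 1)%nat with (n + 1 + 1)%nat by lia.
  rewrite <- (pairs_succ s0 s1 (n + 1)). apply IH.
Qed.

Lemma sweep_DE (n : nat) (l r : list symbol) :
  run (2 * n) (qE, l, pairs s1 s0 n r) (qE, pairs s1 s0 n l, r).
Proof.
  revert l; induction n as [|n IH]; intros l; [reflexivity|].
  apply (run_trans_eq 2 (2 * n) _ _ (qE, s1 :: s0 :: l, pairs s1 s0 n r));
    [reflexivity | | lia].
  cbn. rewrite pairs_shift, pairs_shift. apply IH.
Qed.

Lemma sweep_AE (n : nat) (l r : list symbol) :
  run (2 * n) (qA, pairs s0 s1 n l, s1 :: r) (qA, l, s1 :: ones (2 * n) r).
Proof.
  revert r; induction n as [|n IH]; intros r; [reflexivity|].
  apply (run_trans_eq 2 (2 * n) _ _ (qA, pairs s0 s1 n l, s1 :: s1 :: s1 :: r));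
    [reflexivity | | lia].
  replace (2 * S n)%nat with (2 * n + 2)%nat by lia.
  rewrite <- ones_add. apply IH.
Qed.

(** * Macro steps *)

Definition Pconf (l : list symbol) (a : nat) : zipper :=
  (qC, l, s1 :: pairs s0 s1 a (ones 6 [])).

Definition Qconf (l : list symbol) (a : nat) : zipper :=
  (qC, l, s1 :: pairs s0 s1 a (ones 8 [])).

(** The head is back at the left part of the tape; its last symbol [x] and the symbols before it
    decide what follows. *)
Definition Dconf (l : list symbol) (x : symbol) (b c : nat) : zipper :=
  (qD, l, x :: pairs s1 s0 b (ones c [])).

Lemma Pconf_Dconf (l : list symbol) (a : nat) :
  run (4 * a + 49) (Pconf l a) (Dconf (tl l) (hd s0 l) (a + 2) 9).
Proof.
  unfold Pconf, Dconf. rewrite pairs_shift.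
  eapply run_trans_eq; [apply sweep_CB | |].
  (* At the right end, whatever [a] and [l] are, [(C1) 1^6] becomes [0 1 0 (D1) 1^9]. *)
  - eapply (run_trans 45); [reflexivity|].
    rewrite (pairs_shift s0 s1 a).
    replace (a + 2)%nat with (S a + 1)%nat by lia.
    apply (sweep_DC (S a) l).
  - lia.
Qed.

Lemma Dconf_zero (l : list symbol) (b c : nat) :
  run (4 * b + 5) (Dconf l s0 b (c + 3))
    (qC, tl l, hd s0 l :: pairs s0 s1 (b + 2) (ones c [])).
Proof.
  unfold Dconf. replace (c + 3)%nat with (S (S (S c))) by lia.
  eapply run_trans_eq; [eapply (run_trans 1); [reflexivity | apply sweep_DE] | |].
  (* [E] and [D] replace the first two 1's of the final block by 0's, and the head turns back. *)
  - eapply (run_trans 2); [reflexivity|].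
    replace (b + 2)%nat with (b + 1 + 1)%nat by lia.
    rewrite <- (pairs_succ s0 s1 (b + 1)).
    apply (sweep_CD b l).
  - lia.
Qed.

(** The hypothesis on [hd] admits [l = []], where the 0 is the blank beyond the left end. *)
Lemma Dconf_one_zero (l : list symbol) (b c : nat) :
  hd s0 l = s0 -> run 2 (Dconf l s1 b c) (Dconf (tl (tl l)) (hd s0 (tl l)) (b + 1) c).
Proof.
  intros Hl. unfold Dconf. rewrite Nat.add_comm.
  unfold run; cbn. rewrite Hl. reflexivity.
Qed.

Lemma Dconf_one_one (l : list symbol) (b c : nat) :
  run 1 (Dconf (s1 :: l) s1 b (c + 1))
    (qC, l, s1 :: pairs s0 s1 (b + 1) (ones c [])).
Proof.
  unfold Dconf. rewrite <- pairs_succ, <- pairs_shift.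
  replace (c + 1)%nat with (S c) by lia. reflexivity.
Qed.

Definition Fconf (m a : nat) : zipper := Pconf (s0 :: blocks m (ones 3 [])) a.

Definition Gconf (m a : nat) : zipper := Qconf (s0 :: blocks m (ones 3 [])) a.

Definition Cconf (n : nat) : zipper := (qA, [], s0 :: ones n []).

Ltac same_conf :=
  unfold Fconf, Gconf, Pconf, Qconf, Dconf, Cconf; repeat (f_equal; try lia).

Lemma Pconf_pair (l : list symbol) (a : nat) :
  run (8 * a + 62) (Pconf (s0 :: s1 :: l) a) (Pconf l (a + 4)).
Proof.
  eapply run_cast.
  - eapply run_trans; [apply Pconf_Dconf | apply (Dconf_zero _ _ 6)].
  - same_conf.
  - lia.
Qed.

Lemma Pconf_pairs (l : list symbol) (n a : nat) :
  run (16 * n * n + (8 * a + 46) * n) (Pconf (pairs s0 s1 n l) a) (Pconf l (a + 4 * n)).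
Proof.
  revert a; induction n as [|n IH]; intros a.
  - eapply (run_cast 0); [reflexivity | same_conf | lia].
  - eapply run_cast.
    + eapply run_trans; [apply Pconf_pair | apply IH].
    + same_conf.
    + nia.
Qed.

Lemma Qconf_Pconf (l : list symbol) (a : nat) :
  run (16 * a * a + 72 * a + 41) (Qconf l a) (Pconf (s0 :: l) (4 * a + 3)).
Proof.
  unfold Qconf. rewrite pairs_shift.
  eapply run_cast.
  - eapply run_trans; [apply sweep_CB|].
    (* At the right end [(C1) 1^8] becomes [0 (C1) (01)^3 1^6]; the [a] pairs just crossed are then
       absorbed by [Pconf_pairs]. *)
    eapply (run_trans 41 _ _ (Pconf (s0 :: pairs s1 s0 a l) 3)); [reflexivity|].
    rewrite pairs_shift. apply Pconf_pairs.
  - same_conf.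
  - nia.
Qed.

(** Read leftwards, [011011] is consumed as [01], [10], [11] by [Pconf_pair], [Dconf_one_zero],
    [Dconf_one_one]; the last leaves eight of the nine 1's, hence a [Qconf]. *)
Lemma Fconf_Gconf (m a : nat) :
  run (12 * a + 130) (Fconf (m + 2) a) (Gconf m (a + 8)).
Proof.
  unfold Fconf. rewrite (Nat.add_comm m).
  eapply run_cast.
  - eapply run_trans; [apply Pconf_pair|].
    eapply run_trans; [apply Pconf_Dconf|].
    eapply run_trans; [apply Dconf_one_zero; reflexivity|].
    apply (Dconf_one_one _ _ 8).
  - same_conf.
  - lia.
Qed.

Lemma Dconf_zero_zero (l : list symbol) (b c : nat) :
  hd s0 l = s0 ->
  run (4 * b + 6) (Dconf l s0 b (c + 3))
    (Dconf (tl (tl l)) (hd s0 (tl l)) (b + 2) (c + 1)).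
Proof.
  intros Hl.
  eapply run_trans_eq; [apply Dconf_zero | |].
  - rewrite Hl. apply (run_trans 1 0 _ (Dconf (tl (tl l)) (hd s0 (tl l)) (b + 2) (c + 1)));
      [|reflexivity].
    unfold Dconf. replace (c + 1)%nat with (S c) by lia.
    cbn [ones]. rewrite <- pairs_shift. reflexivity.
  - lia.
Qed.

(** After [Qconf_Pconf], [00] and [11] are consumed; this takes two and then one of the nine 1's,
    hence a [Pconf]. *)
Lemma Gconf_Fconf (m a : nat) :
  run (16 * a * a + 104 * a + 129) (Gconf (m + 1) a) (Fconf m (4 * a + 8)).
Proof.
  unfold Gconf. rewrite (Nat.add_comm m).
  eapply run_cast.
  - eapply run_trans; [apply Qconf_Pconf|].
    eapply run_trans; [apply Pconf_Dconf|].
    eapply run_trans; [apply (Dconf_zero_zero _ _ 6); reflexivity|].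
    apply (Dconf_one_one _ _ 6).
  - same_conf.
  - lia.
Qed.

(* One return trip over the whole tape turns two more 1's of the final block
   into a pair. *)
Lemma Dconf_Cconf (b : nat) :
  run (20 * b + 112) (Dconf [] s0 b 9) (Cconf (2 * b + 21)).
Proof.
  eapply run_cast.
  - eapply run_trans; [apply (Dconf_zero_zero [] _ 6); reflexivity|].
    eapply run_trans; [apply (Dconf_zero_zero [] _ 4); reflexivity|].
    eapply run_trans; [apply (Dconf_zero_zero [] _ 2); reflexivity|].
    eapply run_trans; [apply (Dconf_zero_zero [] _ 0); reflexivity|].
    (* A single 1 is left of the final block: [E] passes over it onto the blanks, and the way back
       fills the tape with 1's. *)
    unfold Dconf. cbn [hd tl].
    eapply (run_trans 1); [reflexivity|].
    eapply run_trans; [apply sweep_DE|].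
    eapply (run_trans 3); [reflexivity|].
    cbn [hd tl]. rewrite <- pairs_shift.
    eapply run_trans.
    + apply (sweep_AE (S (b + 2 + 2 + 2 + 2)) []).
    + apply (run_trans 2 0 _
        (qA, [], s0 :: ones 2 (ones (2 * S (b + 2 + 2 + 2 + 2)) (ones 1 []))));
        reflexivity.
  - rewrite !ones_add. same_conf.
  - lia.
Qed.

(** The head works through the prefix [111] until [D] scans a blank at the left end. Endings for
    [F(0)], [F(1)], [G(0)] suffice: [F(2)] leads to [G(0)], [G(1)] to [F(0)], [G(2)] to [F(1)]. *)
Lemma Fconf_0_Cconf (a : nat) :
  run (16 * a * a + 404 * a + 2402) (Fconf 0 a) (Cconf (8 * a + 87)).
Proof.
  eapply run_cast.
  - eapply run_trans; [apply Pconf_pair|].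
    eapply run_trans; [apply Pconf_Dconf|].
    eapply run_trans; [apply (Dconf_one_one [] _ 8)|].
    eapply run_trans; [apply Qconf_Pconf|].
    eapply run_trans; [apply Pconf_Dconf|].
    apply Dconf_Cconf.
  - same_conf.
  - lia.
Qed.

Lemma Fconf_1_Cconf (a : nat) :
  run (16 * a * a + 468 * a + 3250) (Fconf 1 a) (Cconf (8 * a + 103)).
Proof.
  eapply run_cast.
  - eapply run_trans; [apply Pconf_pair|].
    eapply run_trans; [apply Pconf_Dconf|].
    eapply run_trans; [apply Dconf_one_zero; reflexivity|].
    eapply run_trans; [apply (Dconf_one_one [s1] _ 8)|].
    eapply run_trans; [apply Qconf_Pconf|].
    eapply run_trans; [apply Pconf_pair|].
    eapply run_trans; [apply Pconf_Dconf|].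
    apply Dconf_Cconf.
  - same_conf.
  - lia.
Qed.

Lemma Gconf_0_Cconf (a : nat) :
  run (16 * a * a + 200 * a + 544) (Gconf 0 a) (Cconf (8 * a + 43)).
Proof.
  eapply run_cast.
  - eapply run_trans; [apply Qconf_Pconf|].
    eapply run_trans; [apply Pconf_Dconf|].
    eapply run_trans; [apply (Dconf_zero_zero _ _ 6); reflexivity|].
    eapply run_trans; [apply (Dconf_one_one [s1] _ 6)|].
    eapply run_trans; [apply Pconf_Dconf|].
    eapply run_trans; [apply Dconf_one_zero; reflexivity|].
    apply Dconf_Cconf.
  - same_conf.
  - lia.
Qed.

(** * Entry from [C(n)] *)

Lemma Cconf_sweep (m n : nat) :
  run (3 * m + 3) (Cconf (3 * m + n + 2)) (qC, blocks m (ones 3 []), ones n []).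
Proof.
  unfold Cconf.
  replace (3 * m + n + 2)%nat with (2 + (3 * m + n))%nat by lia.
  rewrite <- ones_add, <- (ones_add (3 * m)).
  (* [A], [B], [F] write the prefix [111] over the scanned 0 and the first two 1's. *)
  eapply run_trans_eq; [apply (run_trans 3 0 _ (qC, ones 3 [], ones (3 * m) (ones n [])));
    reflexivity | apply sweep_CBF | lia].
Qed.

Lemma Cconf_Fconf (m : nat) : run (3 * m + 44) (Cconf (3 * m + 11)) (Fconf m 3).
Proof.
  replace (3 * m + 11)%nat with (3 * m + 9 + 2)%nat by lia.
  eapply run_trans_eq; [apply Cconf_sweep | apply (run_trans 41 0 _ (Fconf m 3)); reflexivity | lia].
Qed.

Lemma Cconf_Gconf (m : nat) : run (3 * m + 56) (Cconf (3 * m + 12)) (Gconf m 3).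
Proof.
  replace (3 * m + 12)%nat with (3 * m + 10 + 2)%nat by lia.
  eapply run_trans_eq; [apply Cconf_sweep | apply (run_trans 53 0 _ (Gconf m 3)); reflexivity | lia].
Qed.

(** * Iteration *)

(** Since [-40/3] is the fixed point of [a -> 4a + 40], each round multiplies [u] by 4. A round
    takes [(16u^2 - 164u - 5)/9] steps; the geometric sums of ratios 16 and 4 bring the denominator
    to 135. *)
Lemma Fconf_iter (j m a : nat) :
  exists t b : nat,
    run t (Fconf (3 * j + m) a) (Fconf m b) /\
    let x := (4 ^ Z.of_nat j)%Z in
    let u := (3 * Z.of_nat a + 40)%Z in
    (3 * Z.of_nat b + 40 = x * u)%Z /\
    (135 * Z.of_nat t
     = 16 * u * u * (x * x - 1) - 820 * u * (x - 1) - 75 * Z.of_nat j)%Z.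
Proof.
  revert a; induction j as [|j IH]; intros a.
  - exists 0%nat, a. split; [reflexivity|]. change (4 ^ Z.of_nat 0)%Z with 1%Z. lia.
  - destruct (IH (4 * a + 40)%nat) as (t & b & Hrun & Hb & Ht).
    exists (16 * a * a + 372 * a + 2115 + t)%nat, b. split.
    + eapply run_trans; [|exact Hrun].
      replace (3 * S j + m)%nat with (3 * j + m + 1 + 2)%nat by lia.
      eapply run_cast; [eapply run_trans; [apply Fconf_Gconf | apply Gconf_Fconf] | |].
      * same_conf.
      * lia.
    + rewrite Nat2Z.inj_succ, Z.pow_succ_r by lia.
      set (x := (4 ^ Z.of_nat j)%Z) in *. cbn zeta in *.
      replace (3 * Z.of_nat (4 * a + 40) + 40)%Z with (4 * (3 * Z.of_nat a + 40))%Z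
        in Hb, Ht by lia.
      split; lia.
Qed.

(** Likewise with the fixed point [-16/3] of [a -> 4a + 16] and rounds of [(16v^2 - 56v - 5)/9]
    steps. *)
Lemma Gconf_iter (j m a : nat) :
  exists t b : nat,
    run t (Gconf (3 * j + m) a) (Gconf m b) /\
    let x := (4 ^ Z.of_nat j)%Z in
    let v := (3 * Z.of_nat a + 16)%Z in
    (3 * Z.of_nat b + 16 = x * v)%Z /\
    (135 * Z.of_nat t
     = 16 * v * v * (x * x - 1) - 280 * v * (x - 1) - 75 * Z.of_nat j)%Z.
Proof.
  revert a; induction j as [|j IH]; intros a.
  - exists 0%nat, a. split; [reflexivity|]. change (4 ^ Z.of_nat 0)%Z with 1%Z. lia.
  - destruct (IH (4 * a + 16)%nat) as (t & b & Hrun & Hb & Ht).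
    exists (16 * a * a + 152 * a + 355 + t)%nat, b. split.
    + eapply run_trans; [|exact Hrun].
      replace (3 * S j + m)%nat with (3 * j + m + 2 + 1)%nat by lia.
      eapply run_cast; [eapply run_trans; [apply Gconf_Fconf | apply Fconf_Gconf] | |].
      * same_conf.
      * lia.
    + rewrite Nat2Z.inj_succ, Z.pow_succ_r by lia.
      set (x := (4 ^ Z.of_nat j)%Z) in *. cbn zeta in *.
      replace (3 * Z.of_nat (4 * a + 16) + 16)%Z with (4 * (3 * Z.of_nat a + 16))%Z
        in Hb, Ht by lia.
      split; lia.
Qed.

(** * Transitions between the [C(n)], and halting *)

Lemma run_Cn_reaches (t n m : nat) (T N : Z) (d e : positive) :
  run t (Cconf n) (Cconf m) ->
  (Zpos d * Z.of_nat t = T)%Z -> (Zpos e * Z.of_nat m = N)%Z ->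
  M4_Cn_reaches n (T # d) (N # e).
Proof.
  intros H HT HN. exists t, m. unfold Qeq; cbn [Qnum Qden inject_Z].
  repeat split; [lia | lia |].
  apply run_reaches. cbn [cstate cleft cscan cright Cn rev].
  rewrite !wpow_ones. exact H.
Qed.

Lemma pow_16 (x : Z) : (0 <= x -> 16 ^ x = 4 ^ x * 4 ^ x)%Z.
Proof. intros Hx. rewrite <- Z.pow_mul_l. reflexivity. Qed.

(** Length 1 modulo 3 makes [F], rather than [B] or [C], read the first blank after the 1's. *)
Lemma halting_run (k : nat) :
  run (3 * k + 3) (Cconf (3 * k + 1)) (qH, blocks k (ones 3 []), []).
Proof.
  destruct k as [|k]; [reflexivity|].
  replace (3 * S k + 1)%nat with (3 * k + 2 + 2)%nat by lia.
  eapply run_trans_eq; [apply Cconf_sweep | | ].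
  - apply (run_trans 3 0 _ (qH, blocks (S k) (ones 3 []), [])); reflexivity.
  - lia.
Qed.

Lemma Cn_halts (k : nat) :
  reaches M4 (3 * k + 3) (Cn (3 * k + 1))
    (Config ([s1; s1; s1] ++ wpow [s0; s1; s1] k) qH s0 []).
Proof.
  intros c Hc. apply on_tape_in_config in Hc. cbn [cstate cleft cscan cright Cn rev] in Hc.
  rewrite wpow_ones in Hc.
  destruct (on_tape_nsteps _ _ _ _ _ Hc (halting_run k)) as (c' & Hn & Hc').
  exists c'; split; [exact Hn|].
  apply on_tape_in_config. cbn [cstate cleft cscan cright].
  rewrite rev_wpow_blocks. now apply on_tape_blank_scan.
Qed.

(* Both [Fconf_iter] and [Gconf_iter] express the time through [x = 4 ^ j] and
   give [3 b + d = x * e]; squaring this equation makes the goal linear in the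
   monomials [x], [x * x], [b] and [b * b]. *)
Ltac solve_count j Hb :=
  rewrite ?Nat2Z.inj_succ, <- ?Z.add_1_r, ?pow_16, ?Z.pow_add_r by lia;
  cbn zeta in *; set (x := (4 ^ Z.of_nat j)%Z) in *;
  let H := fresh in pose proof (f_equal2 Z.mul Hb Hb) as H; lia.

(** The length modulo 3 selects [F] or [G], and modulo 9 the number of blocks left after the rounds.
    Here [9(j+1) + 5 = 3(3j+1) + 11], so [j] rounds end in [F(1,b)]. *)
Lemma Cn_reaches_9_5 (k : nat) :
  let K := Z.of_nat k in
  M4_Cn_reaches (9 * k + 5)
    ((4802 * 16 ^ (K + 1) + 6370 * 4 ^ (K + 1) + 2280 * K - 25362) # 270)
    ((98 * 4 ^ K - 11) # 3).
Proof.
  destruct k as [|j]; cbn zeta.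
  (* [C(5)] is too short for [Cconf_Fconf], which starts at [C(11)]; its run is computed
     outright. *)
  - now apply (run_Cn_reaches 285 5 29).
  - destruct (Fconf_iter j 1 3) as (t & b & Hrun & Hb & Ht).
    eapply run_Cn_reaches.
    + replace (9 * S j + 5)%nat with (3 * (3 * j + 1) + 11)%nat by lia.
      eapply run_trans; [apply Cconf_Fconf|].
      eapply run_trans; [exact Hrun | apply Fconf_1_Cconf].
    + solve_count j Hb.
    + solve_count j Hb.
Qed.

Lemma Cn_reaches_9_6 (k : nat) :
  let K := Z.of_nat k in
  M4_Cn_reaches (9 * k + 6)
    ((125 * 16 ^ (K + 2) - 575 * 4 ^ (K + 2) + 228 * K - 2226) # 27)
    ((50 * 4 ^ (K + 1) - 59) # 3).
Proof.
  destruct k as [|j]; cbn zeta.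
  - now apply (run_Cn_reaches 762 6 47).
  - destruct (Gconf_iter j 1 3) as (t & b & Hrun & Hb & Ht).
    eapply run_Cn_reaches.
    + replace (9 * S j + 6)%nat with (3 * (3 * j + 1) + 12)%nat by lia.
      eapply run_trans; [apply Cconf_Gconf|].
      eapply run_trans; [exact Hrun|].
      eapply run_trans; [apply (Gconf_Fconf 0) | apply Fconf_0_Cconf].
    + solve_count j Hb.
    + solve_count j Hb.
Qed.

Lemma Cn_reaches_9_8 (k : nat) :
  let K := Z.of_nat k in
  M4_Cn_reaches (9 * k + 8)
    ((4802 * 16 ^ (K + 1) + 6370 * 4 ^ (K + 1) + 2280 * K - 11592) # 270)
    ((98 * 4 ^ K + 1) # 3).
Proof.
  destruct k as [|j]; cbn zeta.
  - now apply (run_Cn_reaches 336 8 33).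
  - destruct (Fconf_iter j 2 3) as (t & b & Hrun & Hb & Ht).
    eapply run_Cn_reaches.
    + replace (9 * S j + 8)%nat with (3 * (3 * j + 2) + 11)%nat by lia.
      eapply run_trans; [apply Cconf_Fconf|].
      eapply run_trans; [exact Hrun|].
      eapply run_trans; [apply (Fconf_Gconf 0) | apply Gconf_0_Cconf].
    + solve_count j Hb.
    + solve_count j Hb.
Qed.

Lemma Cn_reaches_9_9 (k : nat) :
  let K := Z.of_nat k in
  M4_Cn_reaches (9 * k + 9)
    ((125 * 16 ^ (K + 2) + 325 * 4 ^ (K + 2) + 228 * K - 2289) # 27)
    ((50 * 4 ^ (K + 1) - 11) # 3).
Proof.
  destruct k as [|j]; cbn zeta.
  - now apply (run_Cn_reaches 1293 9 63).
  - destruct (Gconf_iter j 2 3) as (t & b & Hrun & Hb & Ht).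
    eapply run_Cn_reaches.
    + replace (9 * S j + 9)%nat with (3 * (3 * j + 2) + 12)%nat by lia.
      eapply run_trans; [apply Cconf_Gconf|].
      eapply run_trans; [exact Hrun|].
      eapply run_trans; [apply (Gconf_Fconf 1) | apply Fconf_1_Cconf].
    + solve_count j Hb.
    + solve_count j Hb.
Qed.

(** [C(11)] is already long enough for [Cconf_Fconf], so [k = 0] needs no separate run. *)
Lemma Cn_reaches_9_11 (k : nat) :
  let K := Z.of_nat k in
  M4_Cn_reaches (9 * k + 11)
    ((4802 * 16 ^ (K + 2) - 11270 * 4 ^ (K + 2) + 2280 * K - 22452) # 270)
    ((98 * 4 ^ (K + 1) - 59) # 3).
Proof.
  cbn zeta.
  destruct (Fconf_iter k 0 3) as (t & b & Hrun & Hb & Ht).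
  eapply run_Cn_reaches.
  - replace (9 * k + 11)%nat with (3 * (3 * k + 0) + 11)%nat by lia.
    eapply run_trans; [apply Cconf_Fconf|].
    eapply run_trans; [exact Hrun | apply Fconf_0_Cconf].
  - solve_count k Hb.
  - solve_count k Hb.
Qed.

Lemma Cn_reaches_9_12 (k : nat) :
  let K := Z.of_nat k in
  M4_Cn_reaches (9 * k + 12)
    ((125 * 16 ^ (K + 2) + 325 * 4 ^ (K + 2) + 228 * K - 912) # 27)
    ((50 * 4 ^ (K + 1) + 1) # 3).
Proof.
  cbn zeta.
  destruct (Gconf_iter k 0 3) as (t & b & Hrun & Hb & Ht).
  eapply run_Cn_reaches.
  - replace (9 * k + 12)%nat with (3 * (3 * k + 0) + 12)%nat by lia.
    eapply run_trans; [apply Cconf_Gconf|].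
    eapply run_trans; [exact Hrun | apply Gconf_0_Cconf].
  - solve_count k Hb.
  - solve_count k Hb.
Qed.

Theorem theorem6p1 :
  reaches M4 29 (Cn 0) (Cn 9) /\
  reaches M4 36 (Cn 2) (Cn 11) /\
  reaches M4 48 (Cn 3) (Cn 13) /\
  forall k : nat,
    let K := Z.of_nat k in
    reaches M4 (3 * k + 3) (Cn (3 * k + 1))
      (Config ([s1; s1; s1] ++ wpow [s0; s1; s1] k) qH s0 []) /\
    M4_Cn_reaches (9 * k + 5)
      ((4802 * 16 ^ (K + 1) + 6370 * 4 ^ (K + 1) + 2280 * K - 25362) # 270)
      ((98 * 4 ^ K - 11) # 3) /\
    M4_Cn_reaches (9 * k + 6)
      ((125 * 16 ^ (K + 2) - 575 * 4 ^ (K + 2) + 228 * K - 2226) # 27)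
      ((50 * 4 ^ (K + 1) - 59) # 3) /\
    M4_Cn_reaches (9 * k + 8)
      ((4802 * 16 ^ (K + 1) + 6370 * 4 ^ (K + 1) + 2280 * K - 11592) # 270)
      ((98 * 4 ^ K + 1) # 3) /\
    M4_Cn_reaches (9 * k + 9)
      ((125 * 16 ^ (K + 2) + 325 * 4 ^ (K + 2) + 228 * K - 2289) # 27)
      ((50 * 4 ^ (K + 1) - 11) # 3) /\
    M4_Cn_reaches (9 * k + 11)
      ((4802 * 16 ^ (K + 2) - 11270 * 4 ^ (K + 2) + 2280 * K - 22452) # 270)
      ((98 * 4 ^ (K + 1) - 59) # 3) /\
    M4_Cn_reaches (9 * k + 12)
      ((125 * 16 ^ (K + 2) + 325 * 4 ^ (K + 2) + 228 * K - 912) # 27)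
      ((50 * 4 ^ (K + 1) + 1) # 3).
Proof.
  split; [now apply run_reaches|].
  split; [now apply run_reaches|].
  split; [now apply run_reaches|].
  intros k K.
  split; [apply Cn_halts|].
  split; [apply Cn_reaches_9_5|].
  split; [apply Cn_reaches_9_6|].
  split; [apply Cn_reaches_9_8|].
  split; [apply Cn_reaches_9_9|].
  split; [apply Cn_reaches_9_11 | apply Cn_reaches_9_12].
Qed.
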